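(* Consider the Kerr metric with $m=1$, $0\le a\le 1$, and put $r_+=1+(1-a^2)^{1/2}$ and $\epsilon=a/r$. If $r\ge2$, then $\mathcal S(r)$ can be isometrically embedded in $\mathbb R^3$ as a surface of revolution. Moreover, there is $\epsilon_0>0$ (independent of $r,a$) such that if $r\ge r_+$ and $\epsilon\le\epsilon_0$, then $\mathcal S(r)$ can be isometrically embedded in $\mathbb R^3$ as a surface of revolution.
   Context: $\mathcal S(r)$ is the closed surface $t=\text{constant}$, $r=\text{constant}$ in Kerr spacetime in Boyer-Lindquist coordinates, with the induced metric $d\sigma^2=\Sigma^2d\theta^2+H\,d\varphi^2$ ($0\le\theta\le\pi$, $0\le\varphi<2\pi$), which extends smoothly across the poles $\theta=0,\pi$. Here, with $m=1$, $\Sigma^2=r^2+a^2\cos^2\theta$, $\Delta=r^2-2r+a^2$, $H=\dfrac{\sin^2\theta\left((r^2+a^2)^2-\Delta a^2\sin^2\theta\right)}{\Sigma^2}$, and $r_+$ is the largest root of $\Delta=0$. The surface of revolution is of the form $X(\theta,\varphi)=(\eta(\theta)\cos\varphi,\eta(\theta)\sin\varphi,\xi(\theta))$ with $\eta=H^{1/2}$ and $\xi(\theta)=\int_{\pi/2}^\theta\left(\frac{-H_\theta^2+4H\Sigma^2}{4H}\right)^{1/2}d\theta$. *)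

(* Defs.v *)
From HB Require Import structures.
From mathcomp Require Import all_boot all_order all_algebra.
From mathcomp Require Import all_classical all_reals all_analysis.

Set Implicit Arguments.
Unset Strict Implicit.
Unset Printing Implicit Defensive.

Import Order.TTheory GRing.Theory Num.Theory.
Import numFieldNormedType.Exports.

Local Open Scope classical_set_scope.
Local Open Scope ring_scope.

Section KerrMetric.
Variables (R : realType) (a r : R).

Definition r_plus : R := 1 + Num.sqrt (1 - a ^+ 2).

Definition kerr_Delta : R := r ^+ 2 - 2 * r + a ^+ 2.

(* The function denoted $\Sigma^2$ (not $\Sigma$) in the line element. *)
Definition kerr_Sigma2 (theta : R) : R := r ^+ 2 + a ^+ 2 * cos theta ^+ 2.

Definition kerr_H (theta : R) : R :=
  sin theta ^+ 2
    * ((r ^+ 2 + a ^+ 2) ^+ 2 - kerr_Delta * a ^+ 2 * sin theta ^+ 2)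
    / kerr_Sigma2 theta.

End KerrMetric.

Section EuclideanSpace.
Variable R : realType.

Definition vec3 (x y z : R) : 'rV[R]_3 := \row_(i < 3) [:: x; y; z]`_i.

Definition dot (u v : 'rV[R]_3) : R := \sum_(i < 3) u ord0 i * v ord0 i.

Definition sphere2 : set 'rV[R]_3 := [set p | dot p p = 1].

Definition polar (theta phi : R) : 'rV[R]_3 :=
  vec3 (sin theta * cos phi) (sin theta * sin phi) (cos theta).

(* C^infinity on the open set U: all iterated directional derivatives
   exist and are differentiable, hence continuous, at every point of U. *)
Definition smooth_on (U : set 'rV[R]_3) (F : 'rV[R]_3 -> 'rV[R]_3) : Prop :=
  forall vs : seq 'rV[R]_3, forall p, U p ->
    differentiable (foldr (fun v G => 'D_v G) F vs) p.

(* Integral from x to y, with the usual sign when y < x. *)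
Definition oriented_integral (f : R -> R) (x y : R) : R :=
  if x <= y then \int[lebesgue_measure]_(t in `[x, y]) f t
  else - \int[lebesgue_measure]_(t in `[y, x]) f t.

End EuclideanSpace.

Section Embedding.
Variables (R : realType) (a r : R).

(* The surface S(r) is modelled on the unit sphere of R^3: the point with
   Boyer-Lindquist angles (theta, phi) is polar theta phi, and the poles
   theta = 0, pi are (0, 0, 1) and (0, 0, -1). F only matters on the sphere;
   a map on the sphere is smooth when it has a smooth extension to an open
   neighbourhood U. As the sphere is compact, an injective immersion is an
   embedding. *)
Definition smooth_embedding (F : 'rV[R]_3 -> 'rV[R]_3) : Prop :=
  [/\ exists U : set 'rV[R]_3,
        [/\ open U, @sphere2 R `<=` U & smooth_on U F],
      forall p q, sphere2 p -> sphere2 q -> F p = F q -> p = q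
    & forall p v, sphere2 p -> dot p v = 0 -> 'D_v F p = 0 -> v = 0].

(* The pullback by F of the Euclidean metric is
   Sigma^2 dtheta^2 + H dphi^2. The chart (theta, phi) degenerates at the
   poles; there, for F smooth, equality with the smooth extension of the metric
   follows by continuity. *)
Definition isometric (F : 'rV[R]_3 -> 'rV[R]_3) : Prop :=
  forall theta phi : R, 0 < theta -> theta < pi ->
    let X_theta := (fun t => F (polar t phi))^`()%classic theta in
    let X_phi := (fun t => F (polar theta t))^`()%classic phi in
    [/\ dot X_theta X_theta = kerr_Sigma2 a r theta,
        dot X_theta X_phi = 0
      & dot X_phi X_phi = kerr_H a r theta].

Definition kerr_eta (theta : R) : R := Num.sqrt (kerr_H a r theta).

(* At theta = 0, pi the integrand is the junk value 0 (H vanishes), which does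
   not affect the integral. Where the radicand is negative Num.sqrt is 0, and
   [isometric] then fails. *)
Definition kerr_xi (theta : R) : R :=
  oriented_integral (fun t =>
    Num.sqrt ((- (kerr_H a r)^`()%classic t ^+ 2
               + 4 * kerr_H a r t * kerr_Sigma2 a r t)
              / (4 * kerr_H a r t))) (pi / 2) theta.

Definition surface_of_revolution (F : 'rV[R]_3 -> 'rV[R]_3) : Prop :=
  forall theta phi : R, 0 <= theta -> theta <= pi ->
    F (polar theta phi) =
      vec3 (kerr_eta theta * cos phi) (kerr_eta theta * sin phi)
           (kerr_xi theta).

Definition isometrically_embeds_as_surface_of_revolution : Prop :=
  exists F : 'rV[R]_3 -> 'rV[R]_3,
    [/\ smooth_embedding F, isometric F & surface_of_revolution F].

End Embedding.

(* Main.v *)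
(* Put z = cos theta, A = r^2 + a^2, b = 2 r a^2 and S(z) = Sigma^2. Then
   H = sin^2(theta) Q(z) with Q = A + b (1 - z^2) / S, and
   Sigma^2 - H_theta^2 / (4 H) = sin^2(theta) K(z) with K rational in z: the
   factor sin^2(theta) can be extracted because of the regularity of the metric
   at the poles. When K > 0 the surface of revolution is therefore the image of
   the unit sphere under
     (x, y, z) |-> (sqrt(Q(z)) x, sqrt(Q(z)) y, - int_0^z sqrt(K)),
   which is smooth on the slab z^2 < 26/25. Both ranges of parameters satisfy
   4 a^2 <= r^2 and 8 a^2 <= r^3, and these two inequalities give K > 0 on the
   slab. *)
Require Import Defs.
From mathcomp Require Import all_boot all_order all_algebra.
From mathcomp Require Import all_classical all_reals all_analysis.
From mathcomp Require Import ring lra.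
Import Order.TTheory GRing.Theory Num.Theory.
Import numFieldNormedType.Exports.
Local Open Scope ring_scope.

Set Implicit Arguments.
Unset Strict Implicit.
Unset Printing Implicit Defensive.
Local Open Scope classical_set_scope.

(** * Smooth functions *)

(** The first-order expansion of [f] at [x] is also one for [g], and uniqueness of the differential
    does the rest. It is needed because iterated derivatives are known in closed form only on an
    open set. *)
Lemma near_eq_differentiable (R : numFieldType) (V W : normedModType R)
    (f g : V -> W) (x : V) :
  (\near x, f x = g x) -> differentiable f x -> differentiable g x.
Proof.
move=> fg df.
have fgx : f x = g x by exact: nbhs_singleton fg.
have gE : g \o shift x = cst (g x) + 'd f x +o_ 0 id.
  apply/eqaddoP => e e0; have /eqaddoP/(_ e e0) := diff_locally df.
  have : \forall h \near 0, f (h + x) = g (h + x).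
    rewrite (near_shift x) sub0r; near=> y.
    by rewrite /= subrK; near: y; exact: fg.
  move=> fgh; apply: filter_app; near=> h => /=.
  by rewrite -fgx !fctE /= (near fgh h).
have dgE := diff_unique (diff_continuous df) gE.
by apply/diff_locallyP; rewrite dgE; split => //; exact: diff_continuous.
Unshelve. all: by end_near. Qed.

Section smooth.
Context {R : realType} {n : nat} (U : set 'rV[R]_n).

(* A class of functions R^n -> R which are differentiable on U and whose
   directional derivatives agree on U with members of the class; this replaces
   Leibniz and Faa di Bruno formulas for derivatives of all orders. *)
Inductive smooth_fun : ('rV[R]_n -> R) -> Prop :=
| smooth_cst c : smooth_fun (cst c)
| smooth_coord i : smooth_fun (fun p => p ord0 i)
| smoothD f g : smooth_fun f -> smooth_fun g -> smooth_fun (f \+ g)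
| smoothM f g : smooth_fun f -> smooth_fun g -> smooth_fun (f \* g)
| smoothV f : smooth_fun f -> (forall p, U p -> f p != 0) ->
    smooth_fun (fun p => (f p)^-1)
| smooth_sqrt f : smooth_fun f -> (forall p, U p -> 0 < f p) ->
    smooth_fun (fun p => Num.sqrt (f p))
| smooth_primitive f h k : smooth_fun f -> smooth_fun (k \o f) ->
    (forall p, U p -> is_derive (f p) 1 h (k (f p))) -> smooth_fun (h \o f).

Lemma smoothN f : smooth_fun f -> smooth_fun (fun p => - f p).
Proof.
move=> sf; rewrite (_ : (fun p => - f p) = cst (-1) \* f).
  exact: smoothM (smooth_cst _) sf.
by apply/funext => p /=; rewrite mulN1r.
Qed.

Lemma diff_comp1 (f : 'rV[R]_n -> R) (h : R -> R) p l :
  differentiable f p -> is_derive (f p) 1 h l ->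
  differentiable (h \o f) p /\ forall v, 'D_v (h \o f) p = l * 'D_v f p.
Proof.
move=> df [dh hl].
have dh' : differentiable h (f p) by exact/derivable1_diffP.
have dhf : differentiable (h \o f) p by exact: differentiable_comp.
split=> // v; rewrite !deriveE// diff_comp//= deriv1E//.
by rewrite derive1E hl mulrC.
Qed.

(** Induction on the class: each differentiation rule stays inside it. The square root and the
    inverse reappear in their own derivatives, and a primitive comes with its derivative [k \o f]
    already in the class. *)
Lemma smooth_funP (f : 'rV[R]_n -> R) : smooth_fun f ->
  (forall p, U p -> differentiable f p) /\
  forall v, exists2 f', smooth_fun f' & forall p, U p -> 'D_v f p = f' p.
Proof.
elim=> {f} [c|i|f g sf [df Df] sg [dg Dg]|f g sf [df Df] sg [dg Dg]
           |f sf [df Df] f0|f sf [df Df] f0|f h k sf [df Df] sk _ hk].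
- split=> [p _|v]; first exact: differentiable_cst.
  by exists (cst 0); [exact: smooth_cst|move=> p _; rewrite derive_cst].
- split=> [p _|v]; first exact: differentiable_coord.
  exists (cst (v ord0 i)); first exact: smooth_cst.
  move=> p _; have /(congr1 (fun M : 'rV_n => M ord0 i)) := derive_id p v.
  by rewrite derive_mx// mxE.
- split=> [p Up|v]; first by apply: differentiableD; [exact: df|exact: dg].
  have [[f' sf' Df'] [g' sg' Dg']] := (Df v, Dg v).
  exists (f' \+ g'); first exact: smoothD.
  move=> p Up; rewrite -[f \+ g]/(f + g) deriveD ?Df' ?Dg'//.
  - exact/diff_derivable/df.
  - exact/diff_derivable/dg.
- split=> [p Up|v]; first by apply: differentiableM; [exact: df|exact: dg].
  have [[f' sf' Df'] [g' sg' Dg']] := (Df v, Dg v).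
  exists ((f \* g') \+ (g \* f')); first by apply: smoothD; exact: smoothM.
  move=> p Up; rewrite -[f \* g]/(f * g) deriveM ?Df' ?Dg'//.
  - exact/diff_derivable/df.
  - exact/diff_derivable/dg.
- have fV p : U p -> is_derive (f p) 1 GRing.inv (- (f p) ^- 2).
    move=> Up; have := is_deriveV (f0 p Up) (is_derive_id (f p) 1).
    by move/is_derive_eq; apply; rewrite /GRing.scale/= mulr1.
  split=> [p Up|v]; first exact: (diff_comp1 (df p Up) (fV p Up)).1.
  have [f' sf' Df'] := Df v.
  exists ((cst (-1) \* ((fun p => (f p)^-1) \* (fun p => (f p)^-1))) \* f').
    apply: (smoothM _ sf'); apply: smoothM; first exact: smooth_cst.
    by apply: smoothM; exact: smoothV.
  move=> p Up; rewrite (diff_comp1 (df p Up) (fV p Up)).2 Df'//=.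
  by rewrite expr2 invfM mulN1r.
- have fs p : U p -> is_derive (f p) 1 Num.sqrt (2 * Num.sqrt (f p))^-1.
    by move=> Up; exact/is_derive1_sqrt/f0.
  split=> [p Up|v]; first exact: (diff_comp1 (df p Up) (fs p Up)).1.
  have [f' sf' Df'] := Df v.
  exists ((fun p => (2 * Num.sqrt (f p))^-1) \* f').
    apply: smoothM => //.
    apply: (@smoothV (cst 2 \* (fun p => Num.sqrt (f p)))).
      by apply: smoothM; [exact: smooth_cst|exact: smooth_sqrt].
    by move=> p Up /=; rewrite mulf_neq0// gt_eqF// sqrtr_gt0 f0.
  by move=> p Up; rewrite (diff_comp1 (df p Up) (fs p Up)).2 Df'.
- split=> [p Up|v]; first exact: (diff_comp1 (df p Up) (hk p Up)).1.
  have [f' sf' Df'] := Df v.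
  exists ((k \o f) \* f'); first exact: smoothM.
  by move=> p Up; rewrite (diff_comp1 (df p Up) (hk p Up)).2 Df'.
Qed.

Lemma differentiable_row m (f : 'I_m -> 'rV[R]_n -> R) p :
  (forall i, differentiable (f i) p) ->
  differentiable (fun q => \row_i f i q : 'rV[R]_m) p.
Proof.
move=> df.
rewrite (_ : (fun q => _) =
  \sum_(i < m) (fun q => f i q *: (delta_mx ord0 i : 'rV[R]_m))).
  by apply: differentiable_sum => i; exact: differentiableZl.
apply/funext => q; rewrite fct_sumE [LHS]row_sum_delta.
by apply: eq_bigr => i _; rewrite mxE.
Qed.

End smooth.

(** Induction on the list of directions: on [U] every iterated derivative is a row of members of the
    class. The equality can be differentiated again because [U] is open. *)
Lemma smooth_on_row (R : realType) (U : set 'rV[R]_3)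
    (f : 'I_3 -> 'rV[R]_3 -> R) : open U -> (forall i, smooth_fun U (f i)) ->
  smooth_on U (fun p => \row_i f i p).
Proof.
move=> oU sf vs.
have [g sg gE] : exists2 g : 'I_3 -> 'rV[R]_3 -> R,
    (forall i, smooth_fun U (g i)) & forall p, U p ->
      foldr (fun v G => 'D_v G) (fun p => \row_i f i p) vs p = \row_i g i p.
  elim: vs => [|v vs [g sg gE]] /=; first by exists f.
  have /choice[g' g'P] i : exists f', smooth_fun U f' /\
      forall p, U p -> 'D_v (g i) p = f' p.
    by have [f' ? ?] := (smooth_funP (sg i)).2 v; exists f'.
  exists g' => [i|p Up]; first by have [] := g'P i.
  rewrite (@near_eq_derive _ _ _ _ (fun p => \row_i g i p)); last first.
    by near=> q; apply: gE; near: q; exact: open_nbhs_nbhs.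
  rewrite derive_mx; last first.
    apply/diff_derivable/differentiable_row => i.
    exact: (smooth_funP (sg i)).1.
  apply/rowP => i; rewrite !mxE -(g'P i).2//.
  by congr ('D_v _ p); apply/funext => q; rewrite mxE.
move=> p Up; apply: (@near_eq_differentiable _ _ _ (fun p => \row_i g i p)).
  by near=> q; apply/esym/gE; near: q; exact: open_nbhs_nbhs.
by apply: differentiable_row => i; exact: (smooth_funP (sg i)).1.
Unshelve. all: by end_near. Qed.

(** * Algebra of the Kerr metric *)

Section kerr.
Context {R : realType} (a r : R).

(* Everything below is a function of z = cos theta, and kerr_Hs is the
   derivative of H with respect to s = 1 - z^2. *)
Definition kerr_A : R := r ^+ 2 + a ^+ 2.
Definition kerr_b : R := 2 * r * a ^+ 2.
Definition kerr_S (z : R) : R := r ^+ 2 + a ^+ 2 * z ^+ 2.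
Definition kerr_Q (z : R) : R := kerr_A + kerr_b * (1 - z ^+ 2) / kerr_S z.
(** With s = 1 - z^2, [s * T] is the derivative of [s^2 / S] in s, and H = A s + b s^2 / S. *)
Definition kerr_T (z : R) : R := (kerr_A + kerr_S z) / kerr_S z ^+ 2.
Definition kerr_Hs (z : R) : R := kerr_A + kerr_b * (1 - z ^+ 2) * kerr_T z.
(** The quotient of [S Q - z^2 Hs^2] by [1 - z^2]. *)
Definition kerr_N (z : R) : R :=
  kerr_A * r ^+ 2 + kerr_b - z ^+ 2 * kerr_b * kerr_T z
    * (2 * kerr_A + kerr_b * (1 - z ^+ 2) * kerr_T z).
Definition kerr_K (z : R) : R := kerr_N z / kerr_Q z.

Hypothesis r_ge1 : 1 <= r.
Hypothesis Delta_ge0 : 0 <= kerr_Delta a r.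

Lemma kerr_S_gt0 z : 0 < kerr_S z.
Proof.
have r0 : 0 < r by exact: lt_le_trans r_ge1.
by apply: ltr_pwDl; [exact: exprn_gt0|apply: mulr_ge0; exact: sqr_ge0].
Qed.

(** [S Q] equals [A r^2 + b + Delta a^2 z^2], so positivity holds for every real z, also off the
    sphere. The sign of [Delta] enters here. *)
Lemma kerr_Q_gt0 z : 0 < kerr_Q z.
Proof.
have S0 := kerr_S_gt0 z.
rewrite (_ : kerr_Q z =
  (kerr_A * r ^+ 2 + kerr_b + kerr_Delta a r * a ^+ 2 * z ^+ 2) / kerr_S z);
  last first.
  rewrite /kerr_Q; apply: (mulIf (lt0r_neq0 S0)).
  rewrite mulrDl !divfK ?gt_eqF//.
  by rewrite /kerr_A /kerr_b /kerr_S /kerr_Delta; ring.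
have r0 : 0 < r by exact: lt_le_trans r_ge1.
have A0 : 0 < kerr_A by rewrite ltr_pwDl ?sqr_ge0 ?exprn_gt0.
have b0 : 0 <= kerr_b by apply: mulr_ge0 (sqr_ge0 a); rewrite mulr_ge0// ltW.
apply: divr_gt0 => //; apply: ltr_pwDl.
  by apply: ltr_pwDl => //; apply: mulr_gt0 => //; exact: exprn_gt0.
by apply: mulr_ge0 (sqr_ge0 z); apply: mulr_ge0 (sqr_ge0 a).
Qed.

Lemma kerr_SQ z :
  kerr_S z * kerr_Q z = kerr_A * kerr_S z + kerr_b * (1 - z ^+ 2).
Proof. by rewrite mulrC /kerr_Q mulrDl divfK// gt_eqF// kerr_S_gt0. Qed.

(** After multiplication by [Q], the terms without [b] give [A S - z^2 A^2 = A r^2 (1 - z^2)], and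
    the others carry the factor [1 - z^2] visibly. The identity is polynomial in [T], which can
    therefore be kept opaque. *)
Lemma kerr_K_identity z :
  kerr_S z - z ^+ 2 * kerr_Hs z ^+ 2 / kerr_Q z = (1 - z ^+ 2) * kerr_K z.
Proof.
have Q0 := lt0r_neq0 (kerr_Q_gt0 z).
apply: (mulIf Q0); rewrite mulrBl divfK// kerr_SQ -(mulrA (1 - _)).
rewrite /kerr_K divfK// /kerr_Hs /kerr_N; move: (kerr_T z) => T.
by rewrite /kerr_S /kerr_A; ring.
Qed.


(** The bound is the value at z = 0, where [T] is largest; once denominators are cleared, the
    difference has nonnegative coefficients in [x = a^2 z^2]. *)
Lemma kerr_T_le z : r ^+ 2 * kerr_T z <= 2 + a ^+ 2 / r ^+ 2.
Proof.
have r0 : 0 < r ^+ 2 by rewrite exprn_gt0// (lt_le_trans _ r_ge1).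
have S0 := kerr_S_gt0 z.
have -> : 2 + a ^+ 2 / r ^+ 2 = (2 * r ^+ 2 + a ^+ 2) / r ^+ 2.
  by rewrite mulrDl mulfK// gt_eqF.
rewrite /kerr_T mulrA ler_pdivrMr ?exprn_gt0// [leRHS]mulrAC ler_pdivlMr//.
have : 0 <= a ^+ 2 * z ^+ 2 by apply: mulr_ge0; exact: sqr_ge0.
rewrite /kerr_A /kerr_S; have := sqr_ge0 a.
move: (r ^+ 2) (a ^+ 2) (a ^+ 2 * z ^+ 2) r0 => q e x q0 e0 x0.
rewrite -subr_ge0 (_ : _ - _ =
  (2 * q + e) * x ^+ 2 + x * q * (3 * q + 2 * e)); last by ring.
have q0' := ltW q0; apply: addr_ge0; apply: mulr_ge0; rewrite ?sqr_ge0//.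
- by apply: addr_ge0 => //; exact: mulr_ge0.
- exact: mulr_ge0.
- by apply: addr_ge0; exact: mulr_ge0.
Qed.

(** The range goes slightly beyond z^2 = 1 so that [sqrt K] is smooth on a neighbourhood of the
    sphere. *)
Lemma kerr_K_gt0 z : z ^+ 2 <= 26 / 25 ->
  4 * a ^+ 2 <= r ^+ 2 -> 8 * a ^+ 2 <= r ^+ 3 -> 0 < kerr_K z.
Proof.
move=> z1 ar2 ar3; rewrite divr_gt0 ?kerr_Q_gt0//.
have r0 : 0 < r by exact: lt_le_trans r_ge1.
have rN0 : r != 0 by rewrite gt_eqF.
(* In units of r: e = a^2/r^2, be = 2 a^2/r^3, and both are at most 1/4. *)
pose e := a ^+ 2 / r ^+ 2; pose be := 2 * a ^+ 2 / r ^+ 3.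
pose c := be * (r ^+ 2 * kerr_T z).
have eE : a ^+ 2 = e * r ^+ 2 by rewrite divfK// expf_neq0.
have beE : kerr_b = be * r ^+ 4.
  by rewrite /be /kerr_b; field; rewrite rN0.
have cE : kerr_b * kerr_T z = c * r ^+ 2 by rewrite beE /c; ring.
have -> : kerr_N z = r ^+ 4 * (1 + e + be
    - z ^+ 2 * c * (2 * (1 + e) + c * (1 - z ^+ 2))).
  have -> : kerr_N z = kerr_A * r ^+ 2 + kerr_b - z ^+ 2 * (kerr_b * kerr_T z)
      * (2 * kerr_A + kerr_b * kerr_T z * (1 - z ^+ 2)).
    by rewrite /kerr_N; ring.
  by rewrite cE beE /kerr_A eE; ring.
rewrite mulr_gt0 ?exprn_gt0//.
have e0 : 0 <= e by rewrite divr_ge0 ?sqr_ge0.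
have e1 : e <= 1 / 4 by rewrite ler_pdivrMr ?exprn_gt0//; lra.
have be0 : 0 <= be
    by apply: divr_ge0; [apply: mulr_ge0; rewrite ?sqr_ge0|exact/exprn_ge0/ltW].
have be1 : be <= 1 / 4 by rewrite ler_pdivrMr ?exprn_gt0//; lra.
have T0 : 0 <= r ^+ 2 * kerr_T z.
  have S0 := kerr_S_gt0 z.
  apply: mulr_ge0 (sqr_ge0 r) _; apply: divr_ge0 (sqr_ge0 _).
  by apply: addr_ge0 (ltW S0); apply: addr_ge0; exact: sqr_ge0.
have T1 : r ^+ 2 * kerr_T z <= 2 + e by exact: kerr_T_le.
have c0 : 0 <= c by exact: mulr_ge0.
have c1 : c <= be * (2 + e) by exact: ler_wpM2l.
move: (z ^+ 2) (sqr_ge0 z) z1 => w w0 w1.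
have c2 : c <= 1 by nra.
have wc : w * (2 * (1 + e) + c * (1 - w)) <= 26 / 25 * (2 * (1 + e)).
  have [w2|w2] := leP w 1.
    have : w * (c * (1 - w)) <= w * (1 - w).
      by apply: ler_wpM2l => //; rewrite ler_piMl// subr_ge0.
    have : 0 <= (1 - w) * (2 * (1 + e) - w) by apply: mulr_ge0; lra.
    nra.
  have : 0 <= w * (c * (w - 1)).
    by apply: mulr_ge0 => //; apply: mulr_ge0 => //; rewrite subr_ge0 ltW.
  have : w * (2 * (1 + e)) <= 26 / 25 * (2 * (1 + e)).
    by apply: ler_wpM2r => //; lra.
  nra.
have := ler_wpM2l c0 wc.
have := ler_wpM2r (_ : 0 <= 26 / 25 * (2 * (1 + e))) c1.
have -> : 0 <= 26 / 25 * (2 * (1 + e)) by lra.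
move=> /(_ isT) h1 h2.
(* In the extreme case [e = be = 1/4] this reads 26/25 * 45/32 < 3/2: any factor below 16/15 would
   do, and 26/25 leaves the slab some room beyond the sphere. *)
suff : be * (2 + e) * (26 / 25 * (2 * (1 + e))) < 1 + e + be by nra.
have : be * ((2 + e) * (26 / 25 * (2 * (1 + e)))) <=
    be * (26 / 25 * (2 * (1 + 1 / 4)) * (2 + 1 / 4)).
  by apply: ler_wpM2l => //; nra.
nra.
Qed.
End kerr.

(** * Primitives and curves *)

(** The integral from [c] is such a primitive. Points to the right of [c] suffice: [c] will be
    chosen to the left of all heights in the slab. *)
Lemma continuous_primitive (R : realType) (f : R -> R) (c : R) :
  continuous f -> exists F, forall x, c < x -> is_derive x 1 F (f x).
Proof.
move=> cf; pose F x := \int[lebesgue_measure]_(t in `[c, x]) f t.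
have dF x : c < x -> derivable F x 1 /\ F^`() x = f x.
  move=> cx; have xu : x < x + 1 by rewrite ltrDl.
  apply: (continuous_FTC1_closed xu _ cx (cf x)).
  apply: continuous_compact_integrable; first exact: segment_compact.
  exact: continuous_subspaceT.
exists F => x /dF; move: (F) => G [dG GE].
by apply: DeriveDef => //; rewrite -derive1E.
Qed.

(** The integrand [f] need only agree with [g] on the segment, since the formula for the integrand
    of xi is valid on [0, pi] alone. *)
Lemma Rintegral_primitive (R : realType) (f g F : R -> R) (x y : R) : x <= y ->
  continuous g -> (forall t : R, is_derive t 1 F (g t)) ->
  (forall t, x <= t <= y -> f t = g t) ->
  \int[lebesgue_measure]_(t in `[x, y]) f t = F y - F x.
Proof.
move=> xy cg dF fg; transitivity (\int[lebesgue_measure]_(t in `[x, y]) g t).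
  by apply: eq_Rintegral => t; rewrite inE/= in_itv/=; exact: fg.
move: xy; rewrite le_eqVlt => /predU1P[->|xy].
  by rewrite set_itv1 Rintegral_set1 subrr.
have cF : continuous F.
  move=> t; apply/differentiable_continuous/derivable1_diffP.
  by have [] := dF t.
rewrite /Rintegral (continuous_FTC2 (F := F) xy) //.
- exact: continuous_subspaceT.
- split; first by move=> t _; have [] := dF t.
  + exact/cvg_at_right_filter/cF.
  + exact/cvg_at_left_filter/cF.
- by move=> t _; rewrite derive1E; have [] := dF t.
Qed.

Lemma oriented_integral_primitive (R : realType) (f g F : R -> R) (x y : R) :
  continuous g -> (forall t : R, is_derive t 1 F (g t)) ->
  (forall t, Num.min x y <= t <= Num.max x y -> f t = g t) ->
  oriented_integral f x y = F y - F x.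
Proof.
move=> cg dF fg; rewrite /oriented_integral; have [xy|yx] := leP x y.
  by apply: (Rintegral_primitive xy cg dF); move: fg; rewrite min_l// max_r.
rewrite (Rintegral_primitive (ltW yx) cg dF) ?opprB//.
by move: fg; rewrite min_r ?max_l// ltW.
Qed.

Lemma is_derive_vec3 (R : realType) (x y z : R -> R) (t x' y' z' : R) :
  is_derive t 1 x x' -> is_derive t 1 y y' -> is_derive t 1 z z' ->
  is_derive t 1 (fun t => vec3 (x t) (y t) (z t)) (vec3 x' y' z').
Proof.
move=> dx dy dz.
have d i : is_derive t 1 (fun t => vec3 (x t) (y t) (z t) ord0 i)
    (vec3 x' y' z' ord0 i).
  rewrite mxE; under eq_fun do rewrite mxE.
  by case: i => [[|[|[|//]]] ?].
have dv : derivable (fun t => vec3 (x t) (y t) (z t)) t 1.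
  by apply/derivable_mxP => i j; rewrite ord1; have [] := d j.
apply: DeriveDef => //; rewrite derive_mx//; apply/rowP => i.
by rewrite mxE; have [] := d i.
Qed.

Lemma dot_vec3 (R : realType) (x y z x' y' z' : R) :
  dot (vec3 x y z) (vec3 x' y' z') = x * x' + y * y' + z * z'.
Proof. by rewrite /dot !big_ord_recl big_ord0 !mxE/= addr0 addrA. Qed.

Lemma sphere2_coord_le1 (R : realType) (p : 'rV[R]_3) :
  sphere2 p -> p ord0 ord_max ^+ 2 <= 1.
Proof.
rewrite /sphere2/= /dot !big_ord_recr big_ord0/= add0r => <-.
by rewrite expr2 lerDr addr_ge0// -expr2 sqr_ge0.
Qed.

(** * The profile curve and the embedding *)

Section kerr_profile.
Context {R : realType} (a r : R).
Hypothesis r_ge1 : 1 <= r.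
Hypothesis Delta_ge0 : 0 <= kerr_Delta a r.
Notation A := (kerr_A a r).
Notation b := (kerr_b a r).
Notation S := (kerr_S a r).
Notation Q := (kerr_Q a r).
Notation Hs := (kerr_Hs a r).
Notation K := (kerr_K a r).

(** Since [Delta = A - 2 r] and [S = A - a^2 sin^2], both numerators equal [A S + b sin^2]. *)
Lemma kerr_HE t : kerr_H a r t = sin t ^+ 2 * Q (cos t).
Proof.
have S0 : S (cos t) != 0 by rewrite gt_eqF// kerr_S_gt0.
rewrite /kerr_H -[kerr_Sigma2 a r t]/(S (cos t)) -mulrA; congr (_ * _).
apply: (mulIf S0); rewrite divfK// [RHS]mulrC kerr_SQ// -sin2cos2.
have := cos2sin2 t; rewrite /kerr_S => ->.
by rewrite /kerr_A /kerr_b /kerr_Delta; ring.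
Qed.

Lemma continuous_kerr_S : continuous S.
Proof.
move=> z; apply: cvgD; first exact: cvg_cst.
by apply: cvgMr; exact: exprn_continuous.
Qed.

Lemma continuous_kerr_Q : continuous Q.
Proof.
move=> z; apply: cvgD; first exact: cvg_cst.
apply: cvgM; last first.
  by apply: cvgV; [rewrite gt_eqF// kerr_S_gt0|exact: continuous_kerr_S].
by apply: cvgMr; apply: cvgB; [exact: cvg_cst|exact: exprn_continuous].
Qed.

Lemma continuous_kerr_K : continuous K.
Proof.
move=> z; apply: cvgM; last first.
  by apply: cvgV; [rewrite gt_eqF// kerr_Q_gt0|exact: continuous_kerr_Q].
have cT : kerr_T a r @ z --> kerr_T a r z.
  apply: cvgM; first by apply: cvgD; [exact: cvg_cst|exact: continuous_kerr_S].
  apply: cvgV; first by rewrite gt_eqF// exprn_gt0// kerr_S_gt0.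
  by apply: (@cvgM _ _ _ _ S S); exact: continuous_kerr_S.
have cz : (fun z => z ^+ 2) @ z --> z ^+ 2 by exact: exprn_continuous.
apply: cvgB; first exact: cvg_cst.
apply: cvgM; first by apply: cvgM cT; apply: cvgMl.
apply: cvgD; first exact: cvg_cst.
by apply: cvgM cT; apply: cvgMr; apply: cvgB cz; exact: cvg_cst.
Qed.

Lemma is_derive_kerr_Q (z : R) : is_derive z 1 Q (- (2 * z * b * A / S z ^+ 2)).
Proof.
have S0 : S z != 0 by rewrite gt_eqF// kerr_S_gt0.
have dX : is_derive z 1 (fun z : R => z ^+ 2) (2 * z).
  by apply: is_derive_eq; rewrite /GRing.scale/=; ring.
have dS : is_derive z 1 S (a ^+ 2 * (2 * z)).
  by apply: is_derive_eq; rewrite /GRing.scale/=; ring.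
have dSV := is_deriveV S0 dS.
rewrite /kerr_Q; apply: is_derive_eq.
(* This form of [A] combines the two terms of the quotient rule into one. *)
rewrite /GRing.scale/= (_ : A = S z + a ^+ 2 * (1 - z ^+ 2)).
  by field.
by rewrite /kerr_A /kerr_S; ring.
Qed.

(** A signed version of eta: it agrees with [sqrt H] on [0, pi] and, unlike it, is differentiable at
    the poles. *)
Definition kerr_radius (t : R) : R := Num.sqrt (Q (cos t)) * sin t.

Lemma kerr_H_radius t : kerr_H a r t = kerr_radius t ^+ 2.
Proof.
by rewrite kerr_HE exprMn sqr_sqrtr ?(ltW (kerr_Q_gt0 _ _ _))// mulrC.
Qed.

Lemma is_derive_kerr_radius (t : R) :
  is_derive t 1 kerr_radius (cos t * Hs (cos t) / Num.sqrt (Q (cos t))).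
Proof.
have Q0 := kerr_Q_gt0 r_ge1 Delta_ge0 (cos t).
have dQ := is_derive1_comp (is_derive_kerr_Q (cos t)) (is_derive_cos t).
have dg := @is_derive1_comp _ Num.sqrt (Q \o cos) t _ _ (is_derive1_sqrt Q0) dQ.
have dh := is_deriveM dg (is_derive_sin t).
apply: (is_derive_eq dh); rewrite /GRing.scale/=.
have g2 := sqr_sqrtr (ltW Q0).
have g0 : Num.sqrt (Q (cos t)) != 0 by rewrite gt_eqF// sqrtr_gt0.
have S0 : S (cos t) != 0 by rewrite gt_eqF// kerr_S_gt0.
(* The product rule for H = s Q(s), with dQ/ds = b A / S^2. *)
have -> : Hs (cos t) = Num.sqrt (Q (cos t)) ^+ 2
    + b * A * sin t ^+ 2 / S (cos t) ^+ 2.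
  by rewrite g2 sin2cos2 /kerr_Q /kerr_Hs /kerr_T; field.
by field; apply/andP.
Qed.

(** This is the square of the derivative of xi: what the radius leaves over from the length of the
    theta direction. *)
Lemma derive_kerr_radius2 (t : R) :
  kerr_Sigma2 a r t - (cos t * Hs (cos t) / Num.sqrt (Q (cos t))) ^+ 2
  = sin t ^+ 2 * K (cos t).
Proof.
rewrite sin2cos2 -kerr_K_identity// !exprMn exprVn sqr_sqrtr//.
exact/ltW/kerr_Q_gt0.
Qed.

(** As H is the square of the radius, [H_theta^2 / (4 H)] is the square of the derivative of the
    radius. *)
Lemma kerr_xi_integrand (t : R) : 0 <= t <= pi ->
  Num.sqrt ((- (kerr_H a r)^`()%classic t ^+ 2
             + 4 * kerr_H a r t * kerr_Sigma2 a r t)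
            / (4 * kerr_H a r t)) = Num.sqrt (K (cos t)) * sin t.
Proof.
move=> t0pi; have s0 : 0 <= sin t by exact: sin_ge0_pi.
(* At the poles the division by zero yields 0, which is also the value of the right-hand side. *)
have [st0|sN0] := eqVneq (sin t) 0.
  by rewrite kerr_HE st0 expr0n/= !(mul0r, mulr0, invr0) sqrtr0.
pose h' := cos t * Hs (cos t) / Num.sqrt (Q (cos t)).
have -> : (kerr_H a r)^`()%classic t = 2 * kerr_radius t * h'.
  have -> : kerr_H a r = (fun t => kerr_radius t ^+ 2).
    by apply/funext => u; exact: kerr_H_radius.
  have dh := is_derive_kerr_radius t; rewrite derive1E.
  apply: derive_val; apply: is_derive_eq; rewrite /GRing.scale/= -/h'; ring.
have Q0 := kerr_Q_gt0 r_ge1 Delta_ge0 (cos t).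
have h0 : kerr_radius t != 0 by rewrite mulf_neq0// gt_eqF// sqrtr_gt0.
rewrite kerr_H_radius (_ : _ / _ = kerr_Sigma2 a r t - h' ^+ 2); last first.
  by field.
by rewrite derive_kerr_radius2 sqrtrM ?sqr_ge0// sqrtr_sqr ger0_norm// mulrC.
Qed.

Lemma kerr_eta_radius (t : R) : 0 <= t <= pi -> kerr_eta a r t = kerr_radius t.
Proof.
move=> t0pi; rewrite /kerr_eta kerr_H_radius sqrtr_sqr ger0_norm//.
by rewrite mulr_ge0 ?sqrtr_ge0 ?sin_ge0_pi.
Qed.

(** The substitution z = cos t: [- F (cos t)] is a primitive of [sqrt (K (cos t)) * sin t], and
    cos(pi/2) = 0. *)
Lemma kerr_xi_primitive (F : R -> R) (t : R) : 0 <= t <= pi ->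
  (forall z : R, -2 < z -> is_derive z 1 F (Num.sqrt (K z))) ->
  kerr_xi a r t = F 0 - F (cos t).
Proof.
move=> t0pi dF; rewrite /kerr_xi.
have -> : F 0 - F (cos t) = - F (cos t) - - F (cos (pi / 2)).
  by rewrite cos_pihalf opprK addrC.
apply: (@oriented_integral_primitive _ _ (fun t => Num.sqrt (K (cos t)) * sin t)
  (fun t => - F (cos t))).
- move=> u; apply: cvgM; last exact: continuous_sin.
  have cKcos : {for u, continuous (K \o cos)}.
    by apply: continuous_comp; [exact: continuous_cos|exact: continuous_kerr_K].
  apply: (@continuous_comp _ _ _ (K \o cos) Num.sqrt) => //.
  exact: sqrt_continuous.
- move=> u; have c2 : -2 < cos u by have := cos_geN1 u; lra.
  have := is_deriveN (is_derive1_comp (dF _ c2) (is_derive_cos u)).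
  by move/is_derive_eq; apply; rewrite mulrN opprK.
- move=> u u0pi; apply: kerr_xi_integrand.
  have := pi_ge0 R; move: t0pi u0pi; rewrite ge_min le_max => /andP[? ?].
  by move=> /andP[/orP[] ? /orP[] ?] ?; lra.
Qed.

End kerr_profile.

(** * The explicit map on a slab around the unit sphere *)

Section kerr_embedding.
Context {R : realType} (a r : R).
Hypothesis r_ge1 : 1 <= r.
Hypothesis Delta_ge0 : 0 <= kerr_Delta a r.
Hypothesis small2 : 4 * a ^+ 2 <= r ^+ 2.
Hypothesis small3 : 8 * a ^+ 2 <= r ^+ 3.
Notation Q := (kerr_Q a r).
Notation K := (kerr_K a r).

Variable Z : R -> R.
Hypothesis Z0 : Z 0 = 0.
Hypothesis dZ : forall z : R, -2 < z -> is_derive z 1 Z (Num.sqrt (K z)).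

Definition kerr_map (p : 'rV[R]_3) : 'rV[R]_3 :=
  vec3 (Num.sqrt (Q (p ord0 ord_max)) * p ord0 ord0)
       (Num.sqrt (Q (p ord0 ord_max)) * p ord0 (inord 1))
       (- Z (p ord0 ord_max)).

(** Only the height is bounded: [Q], [K] and [Z] depend on it alone, and the map is linear in the
    other two coordinates. *)
Definition slab : set 'rV[R]_3 := [set p | p ord0 ord_max ^+ 2 < 26 / 25].

Lemma slab_gtN2 p : slab p -> -2 < p ord0 ord_max.
Proof. by rewrite /slab/= => h; nra. Qed.

Lemma slab_K_gt0 p : slab p -> 0 < K (p ord0 ord_max).
Proof. by move=> /ltW Up; exact: kerr_K_gt0. Qed.

Lemma sphere2_slab : @sphere2 R `<=` slab.
Proof.
by move=> p /sphere2_coord_le1 p1; apply: le_lt_trans p1 _; lra.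
Qed.

Lemma open_slab : open slab.
Proof.
rewrite (_ : slab = (fun p : 'rV[R]_3 => p ord0 ord_max ^+ 2)
    @^-1` [set x | x < 26 / 25]) //.
apply: open_comp; last exact: open_lt.
move=> p _; apply: (@continuous_comp _ _ _ (fun p : 'rV[R]_3 => p ord0 ord_max)
  (fun x => x ^+ 2)); last exact: exprn_continuous.
exact/differentiable_continuous/differentiable_coord.
Qed.

Lemma smooth_kerr_S : smooth_fun slab (fun p => kerr_S a r (p ord0 ord_max)).
Proof.
apply: (smoothD (smooth_cst _ _) (smoothM (smooth_cst _ (a ^+ 2)) _)).
by apply: smoothM; exact: smooth_coord.
Qed.

Lemma smooth_kerr_Q : smooth_fun slab (fun p => Q (p ord0 ord_max)).
Proof.
have sz : smooth_fun slab (fun p => p ord0 ord_max ^+ 2).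
  by apply: smoothM; exact: smooth_coord.
apply: (smoothD (smooth_cst _ _) (smoothM _ (smoothV smooth_kerr_S _))).
  exact: (smoothM (smooth_cst _ _) (smoothD (smooth_cst _ _) (smoothN sz))).
by move=> p _; rewrite gt_eqF// kerr_S_gt0.
Qed.

Lemma smooth_kerr_K : smooth_fun slab (fun p => K (p ord0 ord_max)).
Proof.
have sz : smooth_fun slab (fun p => p ord0 ord_max ^+ 2).
  by apply: smoothM; exact: smooth_coord.
have s1z := smoothD (smooth_cst _ 1) (smoothN sz).
have sT : smooth_fun slab (fun p => kerr_T a r (p ord0 ord_max)).
  apply: (smoothM (smoothD (smooth_cst _ _) smooth_kerr_S)
    (smoothV (smoothM smooth_kerr_S smooth_kerr_S) _)).
  by move=> p _ /=; rewrite mulf_neq0// gt_eqF// kerr_S_gt0.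
apply: (smoothM _ (smoothV smooth_kerr_Q _)); last first.
  by move=> p _; rewrite gt_eqF// kerr_Q_gt0.
apply: (smoothD (smooth_cst _ _) (smoothN (smoothM
  (smoothM (smoothM sz (smooth_cst _ _)) sT) (smoothD (smooth_cst _ _)
  (smoothM (smoothM (smooth_cst _ _) s1z) sT))))).
Qed.

Lemma smooth_kerr_map : smooth_on slab kerr_map.
Proof.
apply: (@smooth_on_row R slab (fun i p =>
  [:: Num.sqrt (Q (p ord0 ord_max)) * p ord0 ord0;
      Num.sqrt (Q (p ord0 ord_max)) * p ord0 (inord 1);
      - Z (p ord0 ord_max)]`_i)).
  exact: open_slab.
have sQ : smooth_fun slab (fun p => Num.sqrt (Q (p ord0 ord_max))).
  by apply: smooth_sqrt smooth_kerr_Q _ => p _; exact: kerr_Q_gt0.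
case=> [[|[|[|//]]] ?] /=.
- exact: smoothM sQ (smooth_coord _ _).
- exact: smoothM sQ (smooth_coord _ _).
(* [Z] has no closed form, so it enters the class through its derivative [sqrt K]. *)
- apply: smoothN; apply: (@smooth_primitive _ _ _ (fun p => p ord0 ord_max) Z
    (Num.sqrt \o K)).
  + exact: smooth_coord.
  + exact: smooth_sqrt smooth_kerr_K slab_K_gt0.
  + by move=> p /slab_gtN2; exact: dZ.
Qed.

Lemma Z_increasing (x y : R) : x ^+ 2 <= 1 -> y ^+ 2 <= 1 -> x < y -> Z x < Z y.
Proof.
move=> x1 y1 xy.
have dZxy (t : R) : t \in `[x, y]%R -> is_derive t 1 Z (Num.sqrt (K t)).
  by rewrite in_itv/= => /andP[xt ty]; apply: dZ; nra.
have dZ' (t : R) : t \in `]x, y[%R -> is_derive t 1 Z (Num.sqrt (K t)).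
  by move=> /subset_itv_oo_cc/dZxy.
have cZ : {within `[x, y], continuous Z}.
  by apply: derivable_within_continuous => t /dZxy[].
have [t + ZE] := MVT xy dZ' cZ.
rewrite in_itv/= => /andP[xt ty]; rewrite -subr_gt0 ZE mulr_gt0 ?subr_gt0//.
rewrite sqrtr_gt0 kerr_K_gt0//.
have xN1 : -1 <= x by nra.
have y1' : y <= 1 by nra.
have : 0 <= (1 - t) * (1 + t) by apply: mulr_ge0; lra.
by move=> ?; nra.
Qed.

(** Monotonicity of [Z] recovers the height; the common factor [sqrt Q > 0] then cancels in the
    other two coordinates. *)
Lemma kerr_map_inj p q : sphere2 p -> sphere2 q -> kerr_map p = kerr_map q ->
  p = q.
Proof.
move=> /sphere2_coord_le1 p1 /sphere2_coord_le1 q1 /rowP pq.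
have pq2 : p ord0 ord_max = q ord0 ord_max.
  have := pq ord_max; rewrite !mxE/= => /oppr_inj Zpq.
  have [lt|lt|//] := ltgtP (p ord0 ord_max) (q ord0 ord_max).
  - by have := Z_increasing p1 q1 lt; rewrite Zpq ltxx.
  - by have := Z_increasing q1 p1 lt; rewrite Zpq ltxx.
have g0 : Num.sqrt (Q (q ord0 ord_max)) != 0.
  by rewrite gt_eqF// sqrtr_gt0 kerr_Q_gt0.
have pq0 := pq ord0; have := pq (inord 1).
rewrite !mxE /= inordK// pq2 => /(mulfI g0) pq1.
move: pq0; rewrite !mxE /= pq2 => /(mulfI g0) pq0.
apply/rowP; case=> [[|[|[|//]]] i].
- by rewrite (_ : Ordinal i = ord0)//; exact/val_inj.
- by rewrite (_ : Ordinal i = inord 1)//; apply/val_inj; rewrite /= inordK.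
- by rewrite (_ : Ordinal i = ord_max)//; exact/val_inj.
Qed.

(** The differential is triangular: its last row is [- sqrt K] times the vertical component of [v].
    Once that component vanishes, so does the derivative of [sqrt Q], and [sqrt Q] times each
    horizontal component remains. *)
Lemma kerr_map_immersion p v : sphere2 p -> 'D_v kerr_map p = 0 -> v = 0.
Proof.
move=> /sphere2_slab Up.
have dF := smooth_kerr_map [::] Up.
rewrite derive_mx; last exact: diff_derivable.
have coordE i : 'D_v (fun p : 'rV[R]_3 => p ord0 i) p = v ord0 i.
  have /(congr1 (fun M : 'rV_3 => M ord0 i)) := derive_id p v.
  by rewrite derive_mx// mxE.
have dc i : derivable (fun p : 'rV[R]_3 => p ord0 i) p v.
  exact/diff_derivable/differentiable_coord.
have [dg _] := smooth_funP (smooth_sqrt smooth_kerr_Q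
  (fun p _ => kerr_Q_gt0 r_ge1 Delta_ge0 (p ord0 ord_max))).
move=> /rowP Fv.
have v2 : v ord0 ord_max = 0.
  have := Fv ord_max; rewrite !mxE/=; under eq_fun do rewrite !mxE/=.
  have [dZp DZp] := diff_comp1 (differentiable_coord p ord0 ord_max)
    (dZ (slab_gtN2 Up)).
  rewrite -[X in 'D_v X p]/(- (Z \o (fun p : 'rV[R]_3 => p ord0 ord_max))).
  rewrite deriveN ?DZp; last exact: diff_derivable.
  rewrite coordE => /eqP; rewrite oppr_eq0 mulf_eq0 gt_eqF/=; first by move/eqP.
  by rewrite sqrtr_gt0; exact: slab_K_gt0.
have g0 : Num.sqrt (Q (p ord0 ord_max)) != 0.
  by rewrite gt_eqF// sqrtr_gt0 kerr_Q_gt0.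
have Dg0 : 'D_v (fun p : 'rV[R]_3 => Num.sqrt (Q (p ord0 ord_max))) p = 0.
  have Qp := is_derive_kerr_Q a r_ge1 (p ord0 ord_max).
  have gp := @is_derive1_comp _ Num.sqrt Q _ _ _
    (is_derive1_sqrt (kerr_Q_gt0 r_ge1 Delta_ge0 (p ord0 ord_max))) Qp.
  rewrite (diff_comp1 (differentiable_coord p ord0 ord_max) gp).2.
  by rewrite coordE v2 mulr0.
have vi i :
    'D_v (fun p : 'rV[R]_3 => Num.sqrt (Q (p ord0 ord_max)) * p ord0 i) p = 0 ->
    v ord0 i = 0.
  rewrite -[X in 'D_v X p]/((fun p : 'rV[R]_3 => Num.sqrt (Q (p ord0 ord_max)))
    * (fun p : 'rV[R]_3 => p ord0 i)).
  rewrite deriveM//; last by apply/diff_derivable/dg.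
  rewrite coordE Dg0 /GRing.scale/= mulr0 addr0 => /eqP.
  by rewrite mulf_eq0 (negbTE g0) => /eqP.
apply/rowP; case=> [[|[|[|//]]] i]; rewrite mxE.
- rewrite (_ : Ordinal i = ord0); last exact/val_inj.
  by apply: vi; have := Fv ord0; rewrite !mxE/=; under eq_fun do rewrite !mxE/=.
- rewrite (_ : Ordinal i = inord 1); last by apply/val_inj; rewrite /= inordK.
  apply: vi; have := Fv (inord 1); rewrite !mxE/=.
  by under eq_fun do rewrite !mxE/= inordK//=.
- by rewrite (_ : Ordinal i = ord_max)//; exact/val_inj.
Qed.

Lemma kerr_map_polar (t phi : R) : kerr_map (polar t phi) =
  vec3 (kerr_radius a r t * cos phi) (kerr_radius a r t * sin phi)
       (- Z (cos t)).
Proof. by rewrite /kerr_map /polar !mxE/= inordK//= !mulrA. Qed.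

(** In the chart the map is a rotated profile curve with velocity [(h', k)]; the theta component of
    the metric reduces to [h'^2 + k^2 = Sigma^2], where [K >= 0] is needed to square the root. *)
Lemma kerr_map_isometric : isometric a r kerr_map.
Proof.
move=> theta phi theta0 thetapi X_theta X_phi.
have Q0 := kerr_Q_gt0 r_ge1 Delta_ge0 (cos theta).
pose h := kerr_radius a r theta.
pose h' := cos theta * kerr_Hs a r (cos theta) / Num.sqrt (Q (cos theta)).
pose k := Num.sqrt (K (cos theta)) * sin theta.
have X_thetaE : X_theta = vec3 (h' * cos phi) (h' * sin phi) k.
  rewrite /X_theta derive1E; apply: derive_val.
  under eq_fun do rewrite kerr_map_polar.
  have dh := is_derive_kerr_radius r_ge1 Delta_ge0 theta.
  apply: is_derive_vec3.
  - by apply: is_derive_eq; rewrite /GRing.scale/= /h'; ring.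
  - by apply: is_derive_eq; rewrite /GRing.scale/= /h'; ring.
  - have c2 : -2 < cos theta by have := cos_geN1 theta; lra.
    have := is_deriveN (is_derive1_comp (dZ c2) (is_derive_cos theta)).
    by move/is_derive_eq; apply; rewrite mulrN opprK.
have X_phiE : X_phi = vec3 (h * - sin phi) (h * cos phi) 0.
  rewrite /X_phi derive1E; apply: derive_val.
  under eq_fun do rewrite kerr_map_polar.
  by apply: is_derive_vec3; apply: is_derive_eq;
    rewrite /GRing.scale/= /h; ring.
have kE : k ^+ 2 = kerr_Sigma2 a r theta - h' ^+ 2.
  rewrite derive_kerr_radius2// exprMn sqr_sqrtr 1?mulrC//.
  apply/ltW/kerr_K_gt0 => //.
  by have := cos2sin2 theta; have := sqr_ge0 (sin theta); lra.
have cs := cos2Dsin2 phi.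
rewrite X_thetaE X_phiE !dot_vec3; split.
- have -> : h' * cos phi * (h' * cos phi) + h' * sin phi * (h' * sin phi)
      + k * k
      = h' ^+ 2 * (cos phi ^+ 2 + sin phi ^+ 2) + k ^+ 2 by ring.
  by rewrite cs kE mulr1 addrC subrK.
- by ring.
- rewrite kerr_H_radius// -/h.
  rewrite (_ : _ + _ = h ^+ 2 * (cos phi ^+ 2 + sin phi ^+ 2)); last by ring.
  by rewrite cs mulr1.
Qed.

Lemma kerr_map_revolution : surface_of_revolution a r kerr_map.
Proof.
move=> theta phi theta0 thetapi; rewrite kerr_map_polar.
have t0pi : 0 <= theta <= pi by rewrite theta0.
rewrite kerr_eta_radius// (kerr_xi_primitive r_ge1 Delta_ge0 t0pi dZ).
by rewrite Z0 sub0r.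
Qed.

End kerr_embedding.

(** * Assembly, and the two ranges of parameters *)

Lemma kerr_isometric_embedding (R : realType) (a r : R) :
  1 <= r -> 0 <= kerr_Delta a r ->
  4 * a ^+ 2 <= r ^+ 2 -> 8 * a ^+ 2 <= r ^+ 3 ->
  isometrically_embeds_as_surface_of_revolution a r.
Proof.
move=> r1 D0 s2 s3.
have cK : continuous (Num.sqrt \o kerr_K a r).
  move=> z; apply: continuous_comp; last exact: sqrt_continuous.
  exact: continuous_kerr_K.
(* Any base point below the slab would do. Subtracting [F 0] then matches the normalisation xi(pi/2)
   = 0. *)
have [F dF] := continuous_primitive (-2) cK.
pose Z z := F z - F 0.
have Z0 : Z 0 = 0 by rewrite /Z subrr.
have dZ (z : R) : -2 < z -> is_derive z 1 Z (Num.sqrt (kerr_K a r z)).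
  move=> /dF dFz; have := is_deriveB dFz (is_derive_cst (F 0) z 1).
  by move/is_derive_eq; apply; rewrite subr0.
exists (kerr_map a r Z); split.
- split.
  + exists slab; split.
    * exact: open_slab.
    * exact: sphere2_slab.
    * exact: smooth_kerr_map.
  + by move=> p q; exact: kerr_map_inj.
  + by move=> p v Sp _; exact: kerr_map_immersion.
- exact: kerr_map_isometric.
- exact: kerr_map_revolution.
Qed.

Theorem corollary3p1 (R : realType) :
  (forall a r : R, 0 <= a -> a <= 1 -> 2 <= r ->
     isometrically_embeds_as_surface_of_revolution a r) /\
  (exists eps0 : R, 0 < eps0 /\
     forall a r : R, 0 <= a -> a <= 1 -> r_plus a <= r -> a / r <= eps0 ->
       isometrically_embeds_as_surface_of_revolution a r).
Proof.
split=> [a r a0 a1 r2|].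
  have a2 : a ^+ 2 <= 1 by rewrite expr_le1.
  have r4 : 4 <= r ^+ 2 by nra.
  apply: kerr_isometric_embedding; rewrite ?/kerr_Delta.
  - lra.
  - by have := sqr_ge0 a; nra.
  - lra.
  - by rewrite exprS; nra.
(* It gives 9 a^2 <= r^2; with r >= 1, hence r^2 <= r^3, both smallness conditions follow. *)
exists (1 / 3); split=> [|a r a0 a1 rp ar]; first lra.
have a2 : a ^+ 2 <= 1 by rewrite expr_le1.
have s0 : 0 <= Num.sqrt (1 - a ^+ 2) by exact: sqrtr_ge0.
have s2 : Num.sqrt (1 - a ^+ 2) ^+ 2 = 1 - a ^+ 2.
  by rewrite sqr_sqrtr// subr_ge0.
have r1 : 1 <= r by rewrite /r_plus in rp; lra.
have ar3 : a <= 1 / 3 * r.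
  by rewrite -ler_pdivrMr// (lt_le_trans _ r1).
have ar2 : 9 * a ^+ 2 <= r ^+ 2.
  have : a ^+ 2 <= (1 / 3 * r) ^+ 2 by rewrite lerXn2r ?nnegrE//; lra.
  by rewrite exprMn; lra.
apply: kerr_isometric_embedding => //.
(* [Delta = (r - 1)^2 - (1 - a^2)], and r - 1 is at least the square root of 1 - a^2. *)
- rewrite /kerr_Delta; rewrite /r_plus in rp.
  move: (Num.sqrt _) s0 s2 rp => s s0 s2 rp; nra.
- by have := sqr_ge0 a; lra.
- have : r ^+ 2 <= r ^+ 3 by exact: ler_weXn2l.
  by have := sqr_ge0 a; lra.
Qed.
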